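(* Let $1<p,q<\infty$. In each of the following cases the projective tensor product $\ell^p_2\otimes_\pi\ell^q_2$ does not have the Mazur Intersection Property: (i) $p$ and $q$ are conjugate exponents, i.e. $\frac1p+\frac1q=1$; (ii) either $p$ or $q$ is equal to $2$; (iii) $2<p,q<\infty$.
   Context: All scalars are real. For $1<p<\infty$, $\ell^p_2$ denotes $\mathbb{R}^2$ with the norm $\|(x_1,x_2)\|=(|x_1|^p+|x_2|^p)^{1/p}$. $X\otimes_\pi Y$ denotes the projective tensor product, i.e. (for finite-dimensional $X,Y$) $X\otimes Y$ with the norm $\|u\|_\pi=\inf\{\sum_i\|x_i\|\|y_i\| : u=\sum_i x_i\otimes y_i\}$, the infimum over all finite representations. A Banach space has the Mazur Intersection Property (MIP) if every closed bounded convex subset of it is an intersection of closed balls. *)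

(* Defs.v *)
From HB Require Import structures.
From mathcomp Require Import all_boot all_order all_algebra.
From mathcomp Require Import interval_inference ring lra.
From mathcomp Require Import all_classical all_reals all_analysis.

Set Implicit Arguments.
Unset Strict Implicit.
Unset Printing Implicit Defensive.

Import Order.TTheory GRing.Theory Num.Theory.
Import numFieldNormedType.Exports.

Local Open Scope classical_set_scope.
Local Open Scope ring_scope.

(* The radii are required to be positive because [closed_ball] is by definition
   the closure of an open ball, hence empty for a nonpositive radius. *)
Definition mazur_intersection_property (R : realType) (V : normedModType R) :
    Prop :=
  forall C : set V,
    closed C -> bounded_set C -> @convex_set R V C ->
    exists F : set (V * R),
      (forall b, F b -> 0 < b.2) /\
      C = \bigcap_(b in F) closed_ball b.1 b.2.

Definition lp_norm (R : realType) (p : R) (x : 'rV[R]_2) : R :=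
  (\sum_(i < 2) `|x 0 i| `^ p) `^ p^-1.

Definition lp2 (R : realType) (p : R) of 1 < p : Type := 'rV[R]_2.

HB.instance Definition _ (R : realType) (p : R) (hp : 1 < p) :=
  GRing.Lmodule.on (lp2 hp).

Lemma lp_norm_sum_ge0 (R : realType) (p : R) (x : 'rV[R]_2) :
  0 <= \sum_(i < 2) `|x 0 i| `^ p.
Proof. by apply: sumr_ge0 => i _; rewrite powR_ge0. Qed.

Lemma lp_norm_ge0 (R : realType) (p : R) (x : 'rV[R]_2) : 0 <= lp_norm p x.
Proof. exact: powR_ge0. Qed.

Lemma lp_norm_powR (R : realType) (p : R) (hp : 1 < p) (x : 'rV[R]_2) :
  lp_norm p x `^ p = \sum_(i < 2) `|x 0 i| `^ p.
Proof.
have p0 : p != 0 by rewrite gt_eqF// (lt_trans _ hp).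
by rewrite /lp_norm -powRrM mulVf// powRr1// lp_norm_sum_ge0.
Qed.

Lemma le_powR_inv (R : realType) (p : R) (hp : 1 < p) (a b : R) :
  0 <= a -> 0 <= b -> a `^ p <= b `^ p -> a <= b.
Proof.
move=> a0 b0 ab; have p0 : 0 < p by rewrite (lt_trans _ hp).
rewrite leNgt; apply/negP => ba; move: ab; apply/negP; rewrite -ltNge.
by rewrite gt0_ltr_powR.
Qed.

Lemma coord_le_lp_norm (R : realType) (p : R) (hp : 1 < p) (x : 'rV[R]_2) i :
  `|x 0 i| <= lp_norm p x.
Proof.
apply: (le_powR_inv hp) => //; first exact: lp_norm_ge0.
rewrite lp_norm_powR// (bigD1 i)//= lerDl.
by apply: sumr_ge0 => j _; rewrite powR_ge0.
Qed.

Lemma lp_norm_eq0 (R : realType) (p : R) (hp : 1 < p) (x : lp2 hp) :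
  lp_norm p x = 0 -> x = 0.
Proof.
move=> x0; apply/rowP => i; apply/eqP; rewrite mxE -normr_le0 -x0.
exact: coord_le_lp_norm.
Qed.

Lemma lp_normZ (R : realType) (p : R) (hp : 1 < p) (l : R) (x : lp2 hp) :
  lp_norm p (l *: x) = `|l| * lp_norm p x.
Proof.
have p0 : p != 0 by rewrite gt_eqF// (lt_trans _ hp).
rewrite /lp_norm.
rewrite (eq_bigr (fun i => `|l| `^ p * `|x 0 i| `^ p)); last first.
  by move=> i _; rewrite mxE normrM powRM.
rewrite -mulr_sumr powRM ?powR_ge0 ?lp_norm_sum_ge0//.
by rewrite -powRrM mulfV// powRr1.
Qed.

Lemma powR_convex (R : realType) (p : R) (hp : 1 < p) (t a b : R) :
  0 <= t <= 1 -> 0 <= a -> 0 <= b ->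
  (t * a + (1 - t) * b) `^ p <= t * a `^ p + (1 - t) * b `^ p.
Proof.
move=> t01 a0 b0.
have ti : Itv.spec (@Itv.num_sem R) (Itv.Real `[0%Z, 1%Z]%R) t.
  by apply/andP; split; [exact: num_real | rewrite in_itv].
have := @convex_powR R p (ltW hp) (Itv.mk ti) a b.
rewrite !inE /= !in_itv /= !andbT => /(_ a0 b0).
by rewrite /conv/=.
Qed.

Lemma weighted_powR_le (R : realType) (p : R) (hp : 1 < p) (A B a b c : R) :
  0 < A -> 0 < B -> 0 <= a -> 0 <= b -> 0 <= c -> c <= a + b ->
  c `^ p <= (A + B) `^ p * (A / (A + B) * (a / A) `^ p +
                            B / (A + B) * (b / B) `^ p).
Proof.
move=> A0 B0 a0 b0 c0 cab; have p0 : 0 < p by rewrite (lt_trans _ hp).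
have AB0 : 0 < A + B by rewrite addr_gt0.
have t01 : 0 <= A / (A + B) <= 1.
  by rewrite divr_ge0 ?(ltW A0) ?(ltW AB0)//= ler_pdivrMr// mul1r lerDl (ltW B0).
have tE : 1 - A / (A + B) = B / (A + B) by field; rewrite gt_eqF.
have aA : 0 <= a / A by rewrite divr_ge0// ltW.
have bB : 0 <= b / B by rewrite divr_ge0// ltW.
have := powR_convex hp t01 aA bB; rewrite tE => H.
apply: le_trans (ler_wpM2l (powR_ge0 _ _) H).
rewrite -powRM; [|exact: ltW|]; last first.
  by rewrite addr_ge0// mulr_ge0// divr_ge0// ltW.
have -> : (A + B) * (A / (A + B) * (a / A) + B / (A + B) * (b / B)) = a + b.
  by field; rewrite !gt_eqF.
apply: ge0_ler_powR => //; first exact: ltW.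
by rewrite nnegrE addr_ge0.
Qed.

Lemma sum_normalized_powR (R : realType) (p : R) (hp : 1 < p) (C : R)
  (z : 'rV[R]_2) : 0 < C -> C = lp_norm p z ->
  \sum_(i < 2) (`|z 0 i| / C) `^ p = 1.
Proof.
move=> C0 CE.
transitivity (\sum_(i < 2) `|z 0 i| `^ p * C^-1 `^ p).
  by apply: eq_bigr => i _; rewrite powRM// invr_ge0 ltW.
rewrite -mulr_suml -lp_norm_powR// -CE -powRM ?invr_ge0 ?(ltW C0)//.
by rewrite divff ?gt_eqF// powR1.
Qed.

Lemma ler_lp_normD (R : realType) (p : R) (hp : 1 < p) (x y : lp2 hp) :
  lp_norm p (x + y) <= lp_norm p x + lp_norm p y.
Proof.
have [/lp_norm_eq0->|x0] := eqVneq (lp_norm p x) 0.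
  by rewrite add0r lerDr lp_norm_ge0.
have [/lp_norm_eq0->|y0] := eqVneq (lp_norm p y) 0.
  by rewrite addr0 lerDl lp_norm_ge0.
have [A AE] : exists A, A = lp_norm p x.
  by eexists; reflexivity.
have [B BE] : exists B, B = lp_norm p y.
  by eexists; reflexivity.
have A0 : 0 < A by rewrite AE lt0r x0 lp_norm_ge0.
have B0 : 0 < B by rewrite BE lt0r y0 lp_norm_ge0.
have AB0 : 0 < A + B by rewrite addr_gt0.
rewrite -AE -BE.
apply: (le_powR_inv hp); [exact: lp_norm_ge0|exact: ltW|].
rewrite (lp_norm_powR hp).
have step (i : 'I_2) := weighted_powR_le hp A0 B0 (normr_ge0 (x 0 i))
  (normr_ge0 (y 0 i)) (normr_ge0 _) (ler_normD (x 0 i) (y 0 i)).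
have xyE (i : 'I_2) : (x + y : 'rV[R]_2) 0 i = x 0 i + y 0 i by rewrite mxE.
under eq_bigr do rewrite xyE.
apply: le_trans (ler_sum _ (fun i _ => step i)) _.
rewrite -mulr_sumr big_split/= -!mulr_sumr.
rewrite (sum_normalized_powR hp A0 AE) (sum_normalized_powR hp B0 BE) !mulr1.
by rewrite -mulrDl divff ?gt_eqF// mulr1.
Qed.

HB.instance Definition _ (R : realType) (p : R) (hp : 1 < p) :=
  @Lmodule_isNormed.Build R (lp2 hp) (lp_norm p)
    (@ler_lp_normD R p hp) (@lp_normZ R p hp) (@lp_norm_eq0 R p hp).

Lemma lp2_normE (R : realType) (p : R) (hp : 1 < p) (x : lp2 hp) :
  `|x| = (`|x 0 0| `^ p + `|x 0 1| `^ p) `^ p^-1.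
Proof.
transitivity (lp_norm p x); first by [].
by rewrite /lp_norm !big_ord_recl big_ord0 addr0; congr ((_ + `|x _ _| `^ _) `^ _);
  apply/val_inj.
Qed.

Definition projective_costs (R : realType) (X Y : normedModType R)
    (T : lmodType R) (tens : X -> Y -> T) (u : T) : set R :=
  [set c | exists (n : nat) (x : 'I_n -> X) (y : 'I_n -> Y),
    u = \sum_(i < n) tens (x i) (y i) /\ c = \sum_(i < n) `|x i| * `|y i|].

Definition projective_norm (R : realType) (X Y : normedModType R)
    (T : lmodType R) (tens : X -> Y -> T) (u : T) : R :=
  inf (projective_costs tens u).

(* The algebraic tensor product of two copies of R^2 is realised as the space of
   2 x 2 matrices, with the outer product as elementary tensors; see
   [outer_universal]. *)
Definition outer (R : realType) (x y : 'rV[R]_2) : 'M[R]_2 := x^T *m y.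

Lemma outerE (R : realType) (x y : 'rV[R]_2) i j :
  outer x y i j = x 0 i * y 0 j.
Proof. by rewrite !mxE big_ord1 mxE. Qed.

Lemma outer_linearl (R : realType) (y : 'rV[R]_2) :
  linear (fun x : 'rV[R]_2 => outer x y).
Proof.
move=> a u v; apply/matrixP => i j.
by rewrite outerE !mxE !big_ord1 !mxE; ring.
Qed.

Lemma outer_linearr (R : realType) (x : 'rV[R]_2) : linear (outer x).
Proof.
move=> a u v; apply/matrixP => i j.
by rewrite outerE !mxE !big_ord1 !mxE; ring.
Qed.

Lemma outer_decomp (R : realType) (u : 'M[R]_2) :
  u = \sum_(i < 2) outer (delta_mx 0 i) (row i u).
Proof.
apply/matrixP => k j; rewrite summxE (bigD1 k)//= big1 ?addr0.
  by rewrite outerE !mxE !eqxx mul1r.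
by move=> i ik; rewrite outerE !mxE eqxx/= eq_sym (negPf ik) mul0r.
Qed.

Lemma outer_universal (R : realType) (W : lmodType R)
    (b : 'rV[R]_2 -> 'rV[R]_2 -> W) :
  (forall y, linear (fun x => b x y)) -> (forall x, linear (b x)) ->
  exists! f : 'M[R]_2 -> W, linear f /\ forall x y, f (outer x y) = b x y.
Proof.
move=> bl br.
pose f (u : 'M[R]_2) : W := \sum_(i < 2) b (delta_mx 0 i) (row i u).
have linD (U : lmodType R) (g : U -> W) : linear g -> g 0 = 0 /\
    (forall n (F : 'I_n -> U), g (\sum_(i < n) F i) = \sum_(i < n) g (F i)) /\
    (forall a v, g (a *: v) = a *: g v).
  move=> gl; have g0 : g 0 = 0.
    have := gl (-1) 0 0; rewrite scaler0 addr0 scaleN1r => ->.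
    by rewrite addNr.
  split=> //; split=> [n F|a v]; last by rewrite -[a *: v]addr0 gl g0 addr0.
  apply: (big_ind2 (fun a b => g a = b)) => // u1 _ u2 _ <- <-.
  by have := gl 1 u1 u2; rewrite !scale1r.
exists f; split; last first.
  move=> g [gl gb]; apply/funext => u.
  rewrite [in RHS](outer_decomp u) (linD _ _ gl).2.1 /f.
  by apply: eq_bigr => i _; rewrite gb.
split=> [a u v|x y].
  rewrite /f scaler_sumr -big_split/=; apply: eq_bigr => i _.
  by rewrite linearP/= br.
rewrite /f {2}(row_sum_delta x) (linD _ _ (bl y)).2.1.
apply: eq_bigr => i _; rewrite (linD _ _ (bl y)).2.2.
rewrite -(linD _ _ (br _)).2.2; congr (b _ _).
by apply/rowP => j; rewrite !(mxE, outerE).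
Qed.

Definition lp2_ptensor (R : realType) (p q : R) of 1 < p & 1 < q : Type :=
  'M[R]_2.

HB.instance Definition _ (R : realType) (p q : R) (hp : 1 < p) (hq : 1 < q) :=
  GRing.Lmodule.on (lp2_ptensor hp hq).

Definition tens (R : realType) (p q : R) (hp : 1 < p) (hq : 1 < q)
    (x : lp2 hp) (y : lp2 hq) : lp2_ptensor hp hq := outer x y.

Lemma projective_costs_nonempty (R : realType) (p q : R) (hp : 1 < p)
    (hq : 1 < q) (u : lp2_ptensor hp hq) :
  projective_costs (@tens R p q hp hq) u !=set0.
Proof.
exists (\sum_(i < 2) `|delta_mx 0 i : lp2 hp| * `|row i u : lp2 hq|).
exists 2%N, (fun i => delta_mx 0 i), (fun i => row i u); split=> //.
exact: outer_decomp.
Qed.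

Lemma projective_costs_ge0 (R : realType) (p q : R) (hp : 1 < p)
    (hq : 1 < q) (u : lp2_ptensor hp hq) :
  lbound (projective_costs (@tens R p q hp hq) u) 0.
Proof.
by move=> _ [n [x [y [_ ->]]]]; apply: sumr_ge0 => i _; rewrite mulr_ge0.
Qed.

Lemma projective_costs_has_inf (R : realType) (p q : R) (hp : 1 < p)
    (hq : 1 < q) (u : lp2_ptensor hp hq) :
  has_inf (projective_costs (@tens R p q hp hq) u).
Proof.
split; first exact: projective_costs_nonempty.
by exists 0; exact: projective_costs_ge0.
Qed.

Lemma projective_norm_le (R : realType) (p q : R) (hp : 1 < p)
    (hq : 1 < q) (u : lp2_ptensor hp hq) (c : R) :
  projective_costs (@tens R p q hp hq) u c ->
  projective_norm (@tens R p q hp hq) u <= c.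
Proof. by move=> uc; apply: ge_inf => //; exact: (projective_costs_has_inf u).2. Qed.

Definition cat_family (A : Type) (n m : nat) (x : 'I_n -> A) (x' : 'I_m -> A)
    (i : 'I_(n + m)) : A :=
  match fintype.split i with inl j => x j | inr j => x' j end.

Lemma sum_cat_family (A B : Type) (V : zmodType) (f : A -> B -> V) (n m : nat)
    (x : 'I_n -> A) (x' : 'I_m -> A) (y : 'I_n -> B) (y' : 'I_m -> B) :
  \sum_(i < n + m) f (cat_family x x' i) (cat_family y y' i) =
  \sum_(i < n) f (x i) (y i) + \sum_(i < m) f (x' i) (y' i).
Proof.
rewrite big_split_ord; congr (_ + _); apply: eq_bigr => i _.
  by rewrite /cat_family (unsplitK (inl i)).
by rewrite /cat_family (unsplitK (inr i)).
Qed.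

Lemma ler_projective_normD (R : realType) (p q : R) (hp : 1 < p)
    (hq : 1 < q) (u v : lp2_ptensor hp hq) :
  projective_norm (@tens R p q hp hq) (u + v) <=
  projective_norm (@tens R p q hp hq) u + projective_norm (@tens R p q hp hq) v.
Proof.
rewrite -lerBlDr; apply: lb_le_inf; first exact: projective_costs_nonempty.
move=> c uc; rewrite lerBlDr -lerBlDl.
apply: lb_le_inf; first exact: projective_costs_nonempty.
move=> d vd; rewrite lerBlDl; apply: projective_norm_le.
move: uc vd => [n [x [y [-> ->]]]] [m [x' [y' [-> ->]]]].
exists (n + m)%N, (cat_family x x'), (cat_family y y'); split.
  exact: esym (sum_cat_family (@tens R p q hp hq) x x' y y').
exact: esym (sum_cat_family (fun a b => `|a| * `|b|) x x' y y').
Qed.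

Lemma projective_normZ_le (R : realType) (p q : R) (hp : 1 < p)
    (hq : 1 < q) (l : R) (u : lp2_ptensor hp hq) : l != 0 ->
  projective_norm (@tens R p q hp hq) (l *: u) <=
  `|l| * projective_norm (@tens R p q hp hq) u.
Proof.
move=> l0; rewrite mulrC -ler_pdivrMr ?normr_gt0//.
apply: lb_le_inf; first exact: projective_costs_nonempty.
move=> _ [n [x [y [-> ->]]]]; rewrite ler_pdivrMr ?normr_gt0// mulrC.
apply: projective_norm_le; exists n, (fun i => l *: x i), y; split.
  rewrite scaler_sumr; apply: eq_bigr => i _.
  by apply/matrixP => j k; rewrite /tens mxE !outerE mxE mulrA.
by rewrite mulr_sumr; apply: eq_bigr => i _; rewrite normrZ mulrA.
Qed.

Lemma entry_le_projective_norm (R : realType) (p q : R) (hp : 1 < p)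
    (hq : 1 < q) (u : lp2_ptensor hp hq) (i j : 'I_2) :
  `|(u : 'M[R]_2) i j| <= projective_norm (@tens R p q hp hq) u.
Proof.
apply: lb_le_inf; first exact: projective_costs_nonempty.
move=> _ [n [x [y [-> ->]]]]; rewrite summxE.
apply: le_trans (ler_norm_sum _ _ _) _; apply: ler_sum => k _.
by rewrite outerE normrM ler_pM// ; exact: coord_le_lp_norm.
Qed.

Lemma projective_norm_eq0 (R : realType) (p q : R) (hp : 1 < p)
    (hq : 1 < q) (u : lp2_ptensor hp hq) :
  projective_norm (@tens R p q hp hq) u = 0 -> u = 0.
Proof.
move=> u0; apply/matrixP => i j; apply/eqP; rewrite mxE -normr_le0 -u0.
exact: entry_le_projective_norm.
Qed.

Lemma projective_normZ (R : realType) (p q : R) (hp : 1 < p)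
    (hq : 1 < q) (l : R) (u : lp2_ptensor hp hq) :
  projective_norm (@tens R p q hp hq) (l *: u) =
  `|l| * projective_norm (@tens R p q hp hq) u.
Proof.
have [->|l0] := eqVneq l 0.
  rewrite scale0r normr0 mul0r; apply/eqP; rewrite eq_le; apply/andP; split.
    apply: projective_norm_le; exists 0%N, (fun=> 0), (fun=> 0).
    by rewrite !big_ord0.
  apply: lb_le_inf; first exact: projective_costs_nonempty.
  exact: projective_costs_ge0.
apply/eqP; rewrite eq_le projective_normZ_le//=.
rewrite -ler_pdivlMl ?normr_gt0// -normfV.
have := projective_normZ_le (l *: u) (invr_neq0 l0).
by rewrite scalerA mulVf// scale1r.
Qed.

HB.instance Definition _ (R : realType) (p q : R) (hp : 1 < p) (hq : 1 < q) :=
  @Lmodule_isNormed.Build R (lp2_ptensor hp hq)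
    (projective_norm (@tens R p q hp hq))
    (@ler_projective_normD R p q hp hq) (@projective_normZ R p q hp hq)
    (@projective_norm_eq0 R p q hp hq).

Lemma lp2_ptensor_normE (R : realType) (p q : R) (hp : 1 < p) (hq : 1 < q)
    (u : lp2_ptensor hp hq) :
  `|u| = inf [set c | exists n (x : 'I_n -> lp2 hp) (y : 'I_n -> lp2 hq),
    u = \sum_(i < n) tens (x i) (y i) /\ c = \sum_(i < n) `|x i| * `|y i|].
Proof. by []. Qed.

(* Main.v *)
(** Bilinear forms [T] bounded by 1 on lp x lq are the functionals of norm at
most 1 on the projective tensor product.  No form near the constant one is
extreme in that ball, and this holds for all [1 < p, q < oo].  Indeed a form
[T] with nearly equal positive entries attains its norm [M] at a pair [(x, y)]
of vectors with positive coordinates bounded away from 0, and stationarity gives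
[T = M (j x (x) j y + l x^perp (x) y^perp)], where [j x] is the functional
norming [x] and [det T = M^2 l].  Since the lp norm satisfies
[(j x . u)^2 + c (x^perp . u)^2 <= |u|^2] with a uniform [c > 0], the value of
[l] may be moved to [e] and to [-e], with [e] independent of [T], without
increasing the norm.  So [T] is a convex combination of two contractive forms
whose determinants are too large for them to be nearly constant.

If a closed ball [B(y, r)] contains the set [C] of matrices with sum of entries
-1 and entries bounded by a large [K], but not 0, then a contractive form [T]
with [T (- y) > r] is negative on [C], hence nearly constant; one of the two
contractive forms above also takes a value greater than [r] at [- y], so it must
be nearly constant as well, a contradiction. *)

Require Import Defs.
From mathcomp Require Import all_boot all_order all_algebra.
From mathcomp Require Import ring lra.
From mathcomp Require Import all_classical all_reals all_analysis.

Import Order.TTheory GRing.Theory Num.Theory.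
Import numFieldNormedType.Exports.
Local Open Scope classical_set_scope.
Local Open Scope ring_scope.

Set Implicit Arguments.
Unset Strict Implicit.
Unset Printing Implicit Defensive.

(** * Power and plane-norm inequalities *)

Section ScalarInequalities.
Context {R : realType}.
Implicit Types (p q r x v k L : R).

(** Young's inequality for the product of [x ^ r] and 1, with conjugate exponents [1/r] and
    [1/(1-r)]. *)
Lemma powR_bernoulli_le r x : 0 < r -> r <= 1 -> 0 <= x ->
  x `^ r <= 1 + r * (x - 1).
Proof.
move=> r0; rewrite le_eqVlt => /orP[/eqP ->|r1] x0.
  by rewrite powRr1// mul1r addrC subrK.
have s0 : 0 < 1 - r by rewrite subr_gt0.
have := @conjugate_powR R (x `^ r) 1 r^-1 (1 - r)^-1 (powR_ge0 _ _) ler01.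
rewrite !invr_gt0 !invrK mulr1 -powRrM mulfV ?gt_eqF// powRr1// powR1.
move=> /(_ r0 s0); rewrite addrC subrK => /(_ erefl).
move=> h; apply: le_trans h _; lra.
Qed.

(** The concave case with exponent [1/r], applied to [x ^ r]. *)
Lemma powR_bernoulli_ge r x : 1 <= r -> 0 <= x ->
  1 + r * (x - 1) <= x `^ r.
Proof.
move=> r1 x0; have r0 : 0 < r by lra.
have ri1 : r^-1 <= 1 by rewrite invf_le1.
have := powR_bernoulli_le _ ri1 (powR_ge0 x r).
rewrite invr_gt0 -powRrM mulfV ?gt_eqF// powRr1// => /(_ r0) h.
have : r * x <= r * (1 + r^-1 * (x `^ r - 1)) by rewrite ler_wpM2l// ltW.
rewrite mulrDr mulrA mulfV ?gt_eqF// mulr1 mul1r; lra.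
Qed.

(** The tangent line of [|v| ^ p] at 1 is improved by a quadratic term. For [p < 2] the power grows
    more slowly than a square, so the gain [k] depends on the bound [L]. *)
Lemma powR_quadratic_minorant p L : 1 < p -> 1 <= L ->
  exists2 k, 0 < k & forall v, `|v| <= L ->
    1 + p * (v - 1) + k * (v - 1) ^+ 2 <= `|v| `^ p.
Proof.
move=> p1 L1; have p0 : 0 < p by lra.
have [p2|p2] := leP 2 p.
  exists (p / 2); first by lra.
  (* Bernoulli for [v^2] with exponent [p/2]; the bound [1 + p/2 (v^2 - 1)] is exactly the required
     left side. *)
  move=> v _; have p21 : 1 <= p / 2 by lra.
  have := powR_bernoulli_ge p21 (sqr_ge0 v).
  have -> : (v ^+ 2) `^ (p / 2) = `|v| `^ p.
    rewrite -[v ^+ 2]real_normK ?num_real// -[`|v| ^+ 2]powR_mulrn// -powRrM.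
    by congr (_ `^ _); rewrite mulrC divfK.
  by move=> h; apply: le_trans h; rewrite le_eqVlt; apply/orP; left;
  apply/eqP; field.
have k0 : 0 < (p - 1) ^+ 2 / L by rewrite divr_gt0 ?exprn_gt0 ?subr_gt0//; lra.
have kp : (p - 1) ^+ 2 / L <= (p - 1) ^+ 2.
  by rewrite ler_pdivrMr ?ler_peMr ?sqr_ge0//; lra.
exists ((p - 1) ^+ 2 / L) => // v vL.
set k := _ / L in k0 kp *.
have key w : 0 <= w -> w <= L -> 1 + p * (w - 1) + k * (w - 1) ^+ 2 <= w `^ p.
  move=> w0 wL.
  have D0 : 0 < 1 + (2 - p) * (w - 1) by nra.
  have DL : 1 + (2 - p) * (w - 1) <= L by nra.
  have hB := @powR_bernoulli_le (2 - p) w ltac:(lra) ltac:(lra) w0.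
  (* With [D = 1 + (2-p)(w-1)], this reads [w^p >= w^2 / D = 1 + p (w-1) + (p-1)^2 (w-1)^2 / D], and
     [D <= L] explains the choice of [k]. *)
  have hw : w ^+ 2 <= w `^ p * (1 + (2 - p) * (w - 1)).
    apply: le_trans (_ : w `^ p * w `^ (2 - p) <= _); last first.
      by rewrite ler_wpM2l ?powR_ge0.
    have [->|wn0] := eqVneq w 0; first by rewrite expr0n/= mulr_ge0 ?powR_ge0.
    rewrite -powRD ?wn0 ?implybT//.
    have -> : p + (2 - p) = 2%:R by lra.
    by rewrite powR_mulrn.
  rewrite -(ler_pM2r D0); apply: le_trans hw.
  have hk : k * (1 + (2 - p) * (w - 1)) <= (p - 1) ^+ 2.
    apply: le_trans (ler_wpM2l (ltW k0) DL) _.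
    by rewrite /k divfK// gt_eqF//; lra.
  have := ler_wpM2r (sqr_ge0 (w - 1)) hk; lra.
have := key `|v| (normr_ge0 _) vL.
have [v0|v0] := leP 0 v; first by rewrite ger0_norm.
rewrite ltr0_norm//; move=> h; apply: le_trans h.
(* For [v < 0] the left side is at most its value at [-v], because [k <= p/2]. *)
have : (p - 1) ^+ 2 <= p / 2 by nra.
nra.
Qed.

End ScalarInequalities.

(** * Quantitative convexity of the plane norm and norming functionals *)

Section PlaneNorm.
Context {R : realType}.
Implicit Types (p q u v x y m c : R).

Definition ell p u1 u2 : R := (`|u1| `^ p + `|u2| `^ p) `^ p^-1.

Lemma ell_ge0 p u1 u2 : 0 <= ell p u1 u2.
Proof. exact: powR_ge0. Qed.

Lemma ell_powR p u1 u2 : 1 < p -> ell p u1 u2 `^ p = `|u1| `^ p + `|u2| `^ p.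
Proof.
by move=> p1; rewrite /ell -powRrM mulVf ?powRr1 ?addr_ge0 ?powR_ge0//; lra.
Qed.

Lemma ell_eq0 p u1 u2 : 1 < p -> ell p u1 u2 = 0 -> u1 = 0 /\ u2 = 0.
Proof.
move=> p1 /(congr1 (fun z => z `^ p)); rewrite ell_powR// powR0; last by lra.
move/eqP; rewrite paddr_eq0 ?powR_ge0// !powR_eq0 !normr_eq0.
by case/andP => /andP[/eqP -> _] /andP[/eqP -> _].
Qed.

Lemma ell_unit p x1 x2 : 0 <= x1 -> 0 <= x2 -> x1 `^ p + x2 `^ p = 1 ->
  ell p x1 x2 = 1.
Proof. by move=> x10 x20 x12; rewrite /ell !ger0_norm// x12 powR1. Qed.

(** The scalar minorant is applied at [u_i / x_i], weighted by [x_i ^ p], and summed over both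
    coordinates. The lower bound [m] on the weights keeps the ratios within [L], since
    [|u_i / x_i| ^ p <= 1/m]. *)
Lemma ell_convexity_unit p m k L x1 x2 u1 u2 : 1 < p -> 0 < m -> 0 < k ->
  m^-1 `^ p^-1 <= L ->
  (forall v, `|v| <= L -> 1 + p * (v - 1) + k * (v - 1) ^+ 2 <= `|v| `^ p) ->
  0 < x1 -> 0 < x2 -> x1 `^ p + x2 `^ p = 1 ->
  m <= x1 `^ p -> m <= x2 `^ p -> `|u1| `^ p + `|u2| `^ p <= 1 ->
  k * m / (2 * p) * (x1 * u2 - x2 * u1) ^+ 2 <=
    1 - (x1 `^ (p - 1) * u1 + x2 `^ (p - 1) * u2).
Proof.
move=> p1 m0 k0 mL H x10 x20 x12 mx1 mx2 u12.
have p0 : 0 < p by lra.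
have main x u : 0 < x -> m <= x `^ p -> `|u| `^ p <= 1 ->
    x `^ p * (1 - p) + p * (x `^ (p - 1) * u) +
    k * m * (u / x - 1) ^+ 2 <= `|u| `^ p.
  move=> x0 mx u1'.
  have uE : `|u| `^ p = x `^ p * `|u / x| `^ p.
    by rewrite -powRM ?(ltW x0)// normrM normfV (gtr0_norm x0)
      mulrCA mulfV ?gt_eqF// mulr1.
  have xp0 : 0 < x `^ p by rewrite powR_gt0.
  have vp : `|u / x| `^ p <= m^-1.
    rewrite -(ler_pM2l xp0) -uE (le_trans u1')// ler_pdivlMr// mul1r//.
  have vL : `|u / x| <= L.
    apply: le_trans mL; rewrite -[leLHS]powRr1// -(@mulfV _ p) ?gt_eqF// powRrM.
    by apply: ge0_ler_powR => //; rewrite ?invr_ge0 ?nnegrE ?powR_ge0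
      ?invr_ge0 ?ltW.
  have xu : x `^ (p - 1) * u = x `^ p * (u / x).
    by rewrite -(mulr_powRB1 (ltW x0) p0); field; rewrite gt_eqF.
  rewrite uE xu; have := ler_wpM2l (ltW xp0) (H _ vL).
  have := ler_wpM2r (mulr_ge0 (ltW k0) (sqr_ge0 (u / x - 1))) mx.
  set A := x `^ p; set w := u / x; set B := `|_| `^ p => h1 h2.
  apply: le_trans h2; rewrite -subr_ge0.
  suff -> : A * (1 + p * (w - 1) + k * (w - 1) ^+ 2) -
    (A * (1 - p) + p * (A * w) + k * m * (w - 1) ^+ 2) =
    A * (k * (w - 1) ^+ 2) - m * (k * (w - 1) ^+ 2) by rewrite subr_ge0.
  by ring.
have x1p0 : 0 <= `|u1| `^ p := powR_ge0 _ _.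
have x2p0 : 0 <= `|u2| `^ p := powR_ge0 _ _.
have h1 := main _ u1 x10 mx1 ltac:(lra).
have h2 := main _ u2 x20 mx2 ltac:(lra).
have le1 x : 0 < x -> x `^ p <= 1 -> x <= 1.
  by move=> x0 xp; apply: (le_powR_inv p1) => //; [exact: ltW|rewrite powR1].
have x11 : x1 <= 1 by apply: le1 => //; rewrite -x12 lerDl powR_ge0.
have x21 : x2 <= 1 by apply: le1 => //; rewrite -x12 lerDr powR_ge0.
set a1 := _ * u1 in h1 *; set a2 := _ * u2 in h2 *.
have dE : x1 * u2 - x2 * u1 = x1 * x2 * (u2 / x2 - u1 / x1).
  by field; rewrite !gt_eqF.
set w1 := u1 / x1 in h1 dE; set w2 := u2 / x2 in h2 dE.
have xx1 : (x1 * x2) ^+ 2 <= 1.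
  by rewrite exprn_ile1 ?mulr_ge0 ?mulr_ile1 ?(ltW x10) ?(ltW x20).
(* The determinant is [x1 x2 (w2 - w1)] with [x1 x2 <= 1], and [(w2 - w1)^2] is at most twice the
   sum of the squared deviations from 1. *)
have hd : (x1 * u2 - x2 * u1) ^+ 2 <= 2 * ((w1 - 1) ^+ 2 + (w2 - 1) ^+ 2).
  rewrite dE exprMn; apply: le_trans (ler_wpM2r (sqr_ge0 _) xx1) _.
  have := sqr_ge0 (w1 + w2 - 2); nra.
have km0 : 0 < k * m by rewrite mulr_gt0.
have := ler_wpM2l (ltW km0) hd.
set d := _ ^+ 2 => hd2.
have p20 : 0 < 2 * p by lra.
have -> : k * m / (2 * p) * d = k * m * d / (2 * p) by field; lra.
rewrite ler_pdivrMr//.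
have e1 : x1 `^ p * (1 - p) + x2 `^ p * (1 - p) = 1 - p.
  by rewrite -mulrDl x12 mul1r.
nra.
Qed.

(* 2-uniform convexity of the norm, localised at the norming functional of a
   unit vector [x] whose coordinates stay away from 0. *)
Lemma ell_convexity p m : 1 < p -> 0 < m -> exists2 c, 0 < c &
  forall x1 x2, 0 < x1 -> 0 < x2 -> x1 `^ p + x2 `^ p = 1 ->
  m <= x1 `^ p -> m <= x2 `^ p -> forall u1 u2,
  (x1 `^ (p - 1) * u1 + x2 `^ (p - 1) * u2) ^+ 2 +
  c * (x1 * u2 - x2 * u1) ^+ 2 <= ell p u1 u2 ^+ 2.
Proof.
move=> p1 m0.
have [k k0 H] := @powR_quadratic_minorant R p (1 + m^-1 `^ p^-1) p1
  ltac:(by rewrite lerDl powR_ge0).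
have c0 : 0 < k * m / (2 * p) by rewrite divr_gt0 ?mulr_gt0//; lra.
exists (k * m / (2 * p)) => // x1 x2 x10 x20 x12 mx1 mx2 u1 u2.
have [/(ell_eq0 p1)[-> ->]|N0] := eqVneq (ell p u1 u2) 0.
  by rewrite !mulr0 addr0 subrr expr0n/= mulr0 addr0 sqr_ge0.
have {}N0 : 0 < ell p u1 u2 by rewrite lt0r N0 ell_ge0.
have NE := ell_powR u1 u2 p1.
set N := ell p u1 u2 in N0 NE *.
have Np0 : 0 < N `^ p by rewrite powR_gt0.
have step w1 w2 : `|w1| `^ p + `|w2| `^ p <= 1 ->
    k * m / (2 * p) * (x1 * w2 - x2 * w1) ^+ 2 <=
    1 - (x1 `^ (p - 1) * w1 + x2 `^ (p - 1) * w2).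
  apply: (ell_convexity_unit p1 m0 k0 _ H) => //.
  by rewrite lerDr.
have uN : `|u1 / N| `^ p + `|u2 / N| `^ p <= 1.
  rewrite !normrM !normfV (gtr0_norm N0) !powRM ?invr_ge0 ?(ltW N0)//.
  rewrite -mulrDl -NE -powRM ?invr_ge0 ?(ltW N0)// mulfV ?gt_eqF//.
  by rewrite powR1.
(* The unit estimate at both signs of [u / N] gives [c d^2 <= 1 - |a| <= 1 - a^2]. *)
have := step _ _ uN; have := step (- (u1 / N)) (- (u2 / N)).
rewrite !normrN => /(_ uN).
set c := _ / _ in c0 *; set A := x1 `^ _; set B := x2 `^ _.
set w1 := u1 / N; set w2 := u2 / N.
have -> : x1 * - w2 - x2 * - w1 = - (x1 * w2 - x2 * w1) by ring.
have -> : A * - w1 + B * - w2 = - (A * w1 + B * w2) by ring.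
have -> : A * u1 + B * u2 = N * (A * w1 + B * w2).
  by rewrite /w1 /w2; field; rewrite gt_eqF.
have -> : x1 * u2 - x2 * u1 = N * (x1 * w2 - x2 * w1).
  by rewrite /w1 /w2; field; rewrite gt_eqF.
set a := A * w1 + _; set d := x1 * w2 - _.
rewrite sqrrN => h1 h2; rewrite !exprMn [c * _]mulrCA -mulrDr.
rewrite ger_pMr ?exprn_gt0//.
have := mulr_ge0 (ltW c0) (sqr_ge0 d).
have [a0|a0] := leP 0 a; nra.
Qed.

(** Cauchy-Schwarz for the vectors [(a, sqrt |l| a')] and [(b, sqrt |l| b')], whose lengths
    [ell_convexity] bounds by the two norms once [|l|] is below both convexity constants. *)
Lemma rank_one_plus_contraction p q m : 1 < p -> 1 < q -> 0 < m ->
  exists2 e, 0 < e &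
  forall x1 x2 y1 y2, 0 < x1 -> 0 < x2 -> 0 < y1 -> 0 < y2 ->
  x1 `^ p + x2 `^ p = 1 -> y1 `^ q + y2 `^ q = 1 ->
  m <= x1 `^ p -> m <= x2 `^ p -> m <= y1 `^ q -> m <= y2 `^ q ->
  forall l u1 u2 v1 v2, `|l| <= e ->
  (x1 `^ (p - 1) * u1 + x2 `^ (p - 1) * u2) *
  (y1 `^ (q - 1) * v1 + y2 `^ (q - 1) * v2) +
  l * ((x2 * u1 - x1 * u2) * (y2 * v1 - y1 * v2)) <=
  ell p u1 u2 * ell q v1 v2.
Proof.
move=> p1 q1 m0.
have [c c0 Hc] := ell_convexity p1 m0; have [d d0 Hd] := ell_convexity q1 m0.
exists (Num.min c d); first by rewrite lt_min c0.
move=> x1 x2 y1 y2 x10 x20 y10 y20 x12 y12 mx1 mx2 my1 my2 l u1 u2 v1 v2.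
rewrite le_min => /andP[lc ld].
have := Hc _ _ x10 x20 x12 mx1 mx2 u1 u2.
have := Hd _ _ y10 y20 y12 my1 my2 v1 v2.
rewrite -[x1 * u2 - _]opprB -[y1 * v2 - _]opprB !sqrrN.
set a := _ + _ `^ _ * u2; set b := _ + _ `^ _ * v2.
set a' := x2 * _ - _; set b' := y2 * _ - _ => hb ha.
have {}ha : a ^+ 2 + `|l| * a' ^+ 2 <= ell p u1 u2 ^+ 2.
  by apply: le_trans ha; rewrite lerD2l ler_wpM2r ?sqr_ge0.
have {}hb : b ^+ 2 + `|l| * b' ^+ 2 <= ell q v1 v2 ^+ 2.
  by apply: le_trans hb; rewrite lerD2l ler_wpM2r ?sqr_ge0.
apply: le_trans (ler_norm _) _.
rewrite -(@ler_pXn2r _ 2%N) ?nnegrE ?mulr_ge0 ?ell_ge0//.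
rewrite real_normK ?num_real// exprMn.
apply: le_trans (ler_pM _ _ ha hb); last 2 first.
- by rewrite addr_ge0 ?sqr_ge0// mulr_ge0 ?sqr_ge0.
- by rewrite addr_ge0 ?sqr_ge0// mulr_ge0 ?sqr_ge0.
rewrite -subr_ge0.
(* Lagrange's identity: the defect is [|l|] times a square, whose inner sign depends on that of
   [l]. *)
have [l0|l0] := ger0P l.
  rewrite [leRHS](_ : _ = l * (a * b' - a' * b) ^+ 2); last by ring.
  by rewrite mulr_ge0 ?sqr_ge0.
rewrite [leRHS](_ : _ = - l * (a * b' + a' * b) ^+ 2); last by ring.
by rewrite mulr_ge0 ?sqr_ge0 ?oppr_ge0 ?ltW.
Qed.

(** Equality case of Hoelder: [x_i] is proportional to [b_i ^ (1/(p-1))], and [B] is the norm of [b]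
    for the conjugate exponent [r]. *)
Lemma dual_norming p b1 b2 : 1 < p -> 0 < b1 -> 0 < b2 ->
  exists x1 x2 B, [/\ 0 < x1, 0 < x2 & x1 `^ p + x2 `^ p = 1] /\
  [/\ 0 < B, b1 = B * x1 `^ (p - 1) & b2 = B * x2 `^ (p - 1)].
Proof.
move=> p1 b10 b20; have p0 : p != 0 by lra.
have p10 : p - 1 != 0 by lra.
set r := p / (p - 1).
set S := b1 `^ r + b2 `^ r.
have S0 : 0 < S by rewrite addr_gt0 ?powR_gt0.
pose x b := b `^ (p - 1)^-1 * S `^ (- p^-1).
have xp b : 0 < b -> x b `^ p = b `^ r / S.
  move=> b0; rewrite /x powRM ?powR_ge0// -!powRrM mulNr mulVf//.
  by rewrite powR_inv1 ?ltW// [_^-1 * p]mulrC.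
have xp1 b : 0 < b -> b = S `^ ((p - 1) / p) * x b `^ (p - 1).
  move=> b0; rewrite /x powRM ?powR_ge0// -!powRrM mulVf// powRr1 ?ltW//.
  rewrite mulrCA -powRD; last by rewrite (gt_eqF S0) implybT.
  have -> : (p - 1) / p + - p^-1 * (p - 1) = 0 by ring.
  by rewrite powRr0 mulr1.
exists (x b1), (x b2), (S `^ ((p - 1) / p)); split; split.
- by rewrite mulr_gt0 ?powR_gt0.
- by rewrite mulr_gt0 ?powR_gt0.
- by rewrite !xp// -mulrDl mulfV ?gt_eqF.
- by rewrite powR_gt0.
- exact: xp1.
- exact: xp1.
Qed.

(* Lagrange condition at a maximum point, obtained from the equality case of
   Hoelder's inequality. *)
Lemma norming_gradient p b1 b2 x1 x2 M : 1 < p -> 0 < b1 -> 0 < b2 ->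
  0 <= x1 -> 0 <= x2 -> x1 `^ p + x2 `^ p = 1 ->
  b1 * x1 + b2 * x2 = M ->
  (forall u1 u2, b1 * u1 + b2 * u2 <= M * ell p u1 u2) ->
  [/\ 0 < x1, 0 < x2, b1 = M * x1 `^ (p - 1) & b2 = M * x2 `^ (p - 1)].
Proof.
move=> p1 b10 b20 x10 x20 x12 xM bM.
have [z1 [z2 [B [[z10 z20 z12] [B0 b1E b2E]]]]] := dual_norming p1 b10 b20.
have p0 : 0 < p by lra.
have e1 : z1 `^ (p - 1) * z1 = z1 `^ p by rewrite mulrC mulr_powRB1// ltW.
have e2 : z2 `^ (p - 1) * z2 = z2 `^ p by rewrite mulrC mulr_powRB1// ltW.
have BM : B <= M.
  have := bM z1 z2; rewrite (ell_unit (ltW z10) (ltW z20) z12) mulr1.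
  by apply: le_trans; rewrite b1E b2E -!mulrA -mulrDr e1 e2 z12 mulr1.
have [c c0] := @ell_convexity p (Num.min (z1 `^ p) (z2 `^ p)) p1
  ltac:(by rewrite lt_min !powR_gt0).
move=> /(_ z1 z2 z10 z20 z12); rewrite !ge_min !lexx orbT => /(_ isT isT x1 x2).
rewrite (ell_unit x10 x20 x12).
move: xM; rewrite b1E b2E -!mulrA -mulrDr.
set a := z1 `^ _ * x1 + _; set d := z1 * x2 - _ => aM.
(* From [B a = M] and [B <= M] follows [a >= 1]; then [a^2 + c d^2 <= 1] forces [a = 1] and [d = 0],
   so [x] equals the norming vector [z]. *)
have a1 : 1 <= a by rewrite -(ler_pM2l B0) mulr1 aM.
move=> h.
have d0 : d = 0.
  apply/eqP; rewrite -sqrf_eq0 eq_le sqr_ge0 andbT -(ler_pM2l c0) mulr0.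
  have : 1 <= a ^+ 2 by rewrite exprn_ege1.
  by rewrite expr1n in h; lra.
have {}aE : a = 1.
  by apply/eqP; rewrite eq_le a1 andbT; move: h; rewrite d0; nra.
have zE : x1 = z1 /\ x2 = z2.
  move: d0 aE e1 e2; rewrite /a /d; set A := _ `^ (p - 1); set C := _ `^ (p - 1).
  move=> d0 aE e1 e2; split.
    rewrite -[LHS]mulr1 -z12 -e1 -e2 -[RHS]mulr1 -aE.
    have : C * (z1 * x2 - z2 * x1) = 0 by rewrite d0 mulr0.
    lra.
  rewrite -[LHS]mulr1 -z12 -e1 -e2 -[RHS]mulr1 -aE.
  have : A * (z1 * x2 - z2 * x1) = 0 by rewrite d0 mulr0.
  lra.
have BME : M = B by rewrite -aM aE mulr1.
by rewrite zE.1 zE.2 BME.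
Qed.

End PlaneNorm.

(** * Linear minorants of sublinear functionals *)

Section SublinearMinorants.
Context {R : realType} {V : lmodType R}.
Implicit Types (P Q : V -> R) (e u : V).

Definition sublinear P :=
  (forall u v, P (u + v) <= P u + P v) /\
  (forall a u, 0 <= a -> P (a *: u) = a * P u).

Lemma sublinear0 P : sublinear P -> P 0 = 0.
Proof. by case=> _ /(_ 0 0 (lexx 0)); rewrite scale0r mul0r. Qed.

(** The Hahn-Banach step in direction [e]: [Q u] is the infimum of [P (u + s e) - s P e] over
    [s >= 0], and [s = 1] gives the bound at [- e]. *)
Lemma sublinear_minorant P e : sublinear P ->
  exists Q, [/\ sublinear Q, (forall u, Q u <= P u) & Q (- e) <= - P e].
Proof.
move=> sP; have [PD PZ] := sP; have P0 := sublinear0 sP.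
pose A u := [set P (u + s *: e) - s * P e | s in [set s : R | 0 <= s]].
have Ane u : A u !=set0 by exists (P (u + 0 *: e) - 0 * P e), 0 => /=.
have Alb u : lbound (A u) (- P (- u)).
  move=> _ [s /= s0 <-]; rewrite -PZ//.
  have := PD (u + s *: e) (- u); rewrite addrAC subrr add0r; lra.
have Ale u s : 0 <= s -> inf (A u) <= P (u + s *: e) - s * P e.
  by move=> s0; apply: ge_inf; [exists (- P (- u)); exact: Alb|exists s].
have Age u b : (forall s, 0 <= s -> b <= P (u + s *: e) - s * P e) ->
    b <= inf (A u).
  by move=> h; apply: lb_le_inf => // _ [s /= s0 <-]; exact: h.
have QP u : inf (A u) <= P u.
  by have := Ale u _ (lexx 0); rewrite scale0r addr0 mul0r subr0.
have QZle a u : 0 < a -> inf (A (a *: u)) <= a * inf (A u).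
  move=> a0; rewrite mulrC -ler_pdivrMr//; apply: (Age) => s s0.
  rewrite ler_pdivrMr//; apply: le_trans (Ale _ (a * s) _) _.
    by rewrite mulr_ge0// ltW.
  by rewrite -scalerA -scalerDr PZ ?(ltW a0)// [leRHS]mulrC mulrBr mulrA.
exists (fun u => inf (A u)); split => //.
- split=> [u v|a u].
    rewrite -lerBlDl; apply: (Age) => s s0; rewrite lerBlDl -lerBlDr.
    apply: (Age) => t t0; rewrite lerBlDr.
    apply: le_trans (Ale _ _ (addr_ge0 t0 s0)) _.
    have := PD (u + t *: e) (v + s *: e).
    by rewrite addrACA -scalerDl mulrDl; lra.
  rewrite le_eqVlt => /predU1P[<-|a0].
    rewrite scale0r mul0r; apply/eqP; rewrite eq_le.
    have := QP 0; rewrite P0 => -> /=; apply: lb_le_inf => //.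
    by have := Alb 0; rewrite oppr0 P0 oppr0.
  apply/eqP; rewrite eq_le QZle//= -ler_pdivlMl//.
  have := QZle a^-1 (a *: u).
  by rewrite invr_gt0 scalerA mulVf ?gt_eqF// scale1r; exact.
- by have := Ale (- e) 1 ler01; rewrite scale1r addNr P0 mul1r sub0r.
Qed.

(** Oddness at [e] is inherited by every smaller sublinear functional, so the directions can be
    treated one after another. *)
Lemma sublinear_minorant_seq P (s : seq V) : sublinear P ->
  exists Q, [/\ sublinear Q, (forall u, Q u <= P u) &
    (forall e, e \in s -> Q (- e) = - Q e)].
Proof.
move=> sP; elim: s => [|e s [Q [sQ QP Qs]]]; first by exists P.
have [Q' [sQ' Q'Q Q'e]] := sublinear_minorant e sQ.
have opp u : Q' (- u) <= - Q' u -> Q' (- u) = - Q' u.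
  move=> h; apply/eqP; rewrite eq_le h/= -subr_ge0 opprK.
  by rewrite -(sublinear0 sQ') -(addNr u) sQ'.1.
exists Q'; split=> // [u|u]; first exact: le_trans (QP _).
rewrite inE => /predU1P[->|/Qs us]; apply: opp.
  by apply: le_trans Q'e _; rewrite lerN2.
by apply: le_trans (Q'Q _) _; rewrite us lerN2.
Qed.

End SublinearMinorants.

(** * Bilinear forms on the plane *)

Section BilinearMaximum.
Context {R : realType}.
Implicit Types (p q u v x y m c : R).

Definition bil (t11 t12 t21 t22 u1 u2 v1 v2 : R) : R :=
  t11 * (u1 * v1) + t12 * (u1 * v2) + t21 * (u2 * v1) + t22 * (u2 * v2).

Lemma ellZ p a u1 u2 : 1 < p -> ell p (a * u1) (a * u2) = `|a| * ell p u1 u2.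
Proof.
move=> p1; rewrite /ell !normrM !powRM// -mulrDr powRM ?addr_ge0 ?powR_ge0//.
by rewrite -powRrM mulfV ?powRr1//; lra.
Qed.

Lemma ell00 p : 1 < p -> ell p 0 0 = 0.
Proof. by move=> p1; have := ellZ 0 0 0 p1; rewrite !mul0r normr0 mul0r. Qed.

Lemma ell_norm p u1 u2 : ell p `|u1| `|u2| = ell p u1 u2.
Proof. by rewrite /ell !normr_id. Qed.

Lemma ell_segment_gt0 p (s : R) : 1 < p -> 0 < ell p s (1 - s).
Proof.
move=> p1; rewrite lt0r ell_ge0 andbT; apply/eqP => /(ell_eq0 p1)[s0 s1]; lra.
Qed.

Lemma ell_normalize p a c : 1 < p -> 0 <= a -> 0 <= c -> 0 < ell p a c ->
  (a / ell p a c) `^ p + (c / ell p a c) `^ p = 1.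
Proof.
move=> p1 a0 c0 l0; have := ellZ (ell p a c)^-1 a c p1.
rewrite gtr0_norm ?invr_gt0// mulVf ?gt_eqF// ![_^-1 * _]mulrC => e1.
have a1 := divr_ge0 a0 (ltW l0); have c1 := divr_ge0 c0 (ltW l0).
by rewrite -{1}(ger0_norm a1) -{1}(ger0_norm c1) -ell_powR// e1 powR1.
Qed.

(** Directions with nonnegative coordinates are parametrised by [(s, 1 - s)], which turns the
    maximisation over two spheres into one over a square. *)
Lemma ell_segment_decomp p u1 u2 : 1 < p -> ell p u1 u2 != 0 ->
  exists2 s, 0 <= s <= 1 & exists2 a, 0 < a &
    [/\ `|u1| = a * s, `|u2| = a * (1 - s) & ell p u1 u2 = a * ell p s (1 - s)].
Proof.
move=> p1 l0; have a0 : 0 < `|u1| + `|u2|.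
  rewrite lt0r addr_ge0// andbT; apply: contraNN l0.
  rewrite paddr_eq0// !normr_eq0 => /andP[/eqP -> /eqP ->].
  by rewrite ell00.
exists (`|u1| / (`|u1| + `|u2|)).
  by rewrite divr_ge0 ?addr_ge0//= ler_pdivrMr// mul1r lerDl.
exists (`|u1| + `|u2|) => //.
have e1 : `|u1| = (`|u1| + `|u2|) * (`|u1| / (`|u1| + `|u2|)).
  by rewrite mulrC divfK// gt_eqF.
have e2 : `|u2| = (`|u1| + `|u2|) * (1 - `|u1| / (`|u1| + `|u2|)).
  by rewrite mulrBr -e1 mulr1 addrC addKr.
split=> //.
have := ellZ (`|u1| + `|u2|) (`|u1| / (`|u1| + `|u2|))
  (1 - `|u1| / (`|u1| + `|u2|)) p1.
by rewrite -e1 -e2 ell_norm gtr0_norm.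
Qed.

Definition row2 (a b : R) : 'rV[R]_2 := \row_i (if i == 0 then a else b).

Lemma norm_row2 p (hp : 1 < p) (a b : R) : `|row2 a b : lp2 hp| = ell p a b.
Proof. by rewrite lp2_normE /ell !mxE. Qed.

Lemma ell_segment_continuous p : 1 < p ->
  continuous (fun s : R => ell p s (1 - s)).
Proof.
move=> hp.
have -> : (fun s : R => ell p s (1 - s)) =
    (fun s => `|s *: (row2 1 (- 1) : lp2 hp) + row2 0 1|).
  apply/funext => s; rewrite -norm_row2; congr `|_|.
  by apply/rowP => i; rewrite !mxE; case: ifP => _; ring.
move=> s; apply: cvg_norm; apply: cvgD; last exact: cvg_cst.
exact: scalel_continuous.
Qed.

Lemma bil_le_norm t11 t12 t21 t22 u1 u2 v1 v2 :
  0 <= t11 -> 0 <= t12 -> 0 <= t21 -> 0 <= t22 ->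
  bil t11 t12 t21 t22 u1 u2 v1 v2 <= bil t11 t12 t21 t22 `|u1| `|u2| `|v1| `|v2|.
Proof.
move=> *; rewrite /bil -!normrM.
by rewrite !lerD// ler_wpM2l// ler_norm.
Qed.

Lemma bil_max p q t11 t12 t21 t22 : 1 < p -> 1 < q ->
  0 <= t11 -> 0 <= t12 -> 0 <= t21 -> 0 <= t22 ->
  exists x1 x2 y1 y2, [/\ 0 <= x1, 0 <= x2 & x1 `^ p + x2 `^ p = 1] /\
    [/\ 0 <= y1, 0 <= y2 & y1 `^ q + y2 `^ q = 1] /\
    forall u1 u2 v1 v2, bil t11 t12 t21 t22 u1 u2 v1 v2 <=
      bil t11 t12 t21 t22 x1 x2 y1 y2 * (ell p u1 u2 * ell q v1 v2).
Proof.
move=> p1 q1 h11 h12 h21 h22.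
set b := bil t11 t12 t21 t22.
(* The homogeneous quotient of the form by the norms is continuous on the compact unit square, where
   both norms are positive; nonnegative entries allow [u] and [v] to be replaced by their absolute
   values. *)
pose f (z : R * R) := b z.1 (1 - z.1) z.2 (1 - z.2) /
  (ell p z.1 (1 - z.1) * ell q z.2 (1 - z.2)).
have [[s t] sA smax] : exists2 c, c \in `[0, 1]%classic `*` `[0, 1]%classic &
    forall z, z \in `[0, 1]%classic `*` `[0, 1]%classic -> f z <= f c.
  apply: compact_EVT_max.
  - by exists (0, 0); split => /=; rewrite in_itv/= lexx ler01.
  - by apply: compact_setX; exact: segment_compact.
  - apply: continuous_subspaceT => -[s t].
    have c1 : (fun z : R * R => z.1) @ (s, t) --> s by exact: cvg_fst.
    have c2 : (fun z : R * R => z.2) @ (s, t) --> t by exact: cvg_snd.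
    have d1 : (fun z : R * R => 1 - z.1) @ (s, t) --> 1 - s.
      by apply: cvgB => //; exact: cvg_cst.
    have d2 : (fun z : R * R => 1 - z.2) @ (s, t) --> 1 - t.
      by apply: cvgB => //; exact: cvg_cst.
    apply: cvgM.
      by rewrite /b /bil; do !apply: cvgD; apply: cvgM;
        first [exact: cvg_cst | apply: cvgM].
    apply: cvgV; first by rewrite mulf_neq0// gt_eqF// ell_segment_gt0.
    apply: cvgM.
      exact: (cvg_comp _ _ c1 (@ell_segment_continuous p p1 s)).
    exact: (cvg_comp _ _ c2 (@ell_segment_continuous q q1 t)).
move: sA; rewrite inE => -[/=]; rewrite !in_itv/= => /andP[s0 s1] /andP[t0 t1].
have N0 := ell_segment_gt0 s p1; have K0 := ell_segment_gt0 t q1.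
exists (s / ell p s (1 - s)), ((1 - s) / ell p s (1 - s)).
exists (t / ell q t (1 - t)), ((1 - t) / ell q t (1 - t)).
have s1' : 0 <= 1 - s by rewrite subr_ge0.
have t1' : 0 <= 1 - t by rewrite subr_ge0.
split.
  split; [exact: divr_ge0 s0 (ltW N0) | exact: divr_ge0 s1' (ltW N0) |].
  exact: ell_normalize p1 s0 s1' N0.
split.
  split; [exact: divr_ge0 t0 (ltW K0) | exact: divr_ge0 t1' (ltW K0) |].
  exact: ell_normalize q1 t0 t1' K0.
set M := b _ _ _ _.
have ME : M = f (s, t).
  rewrite /M /f /b /bil/=; move: N0 K0.
  move: (ell p s (1 - s)) (ell q t (1 - t)) => N K N0 K0.
  by field; rewrite !gt_eqF.
move=> u1 u2 v1 v2; apply: le_trans (bil_le_norm _ _ _ _ h11 h12 h21 h22) _.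
have [/(ell_eq0 p1)[-> ->]|lu] := eqVneq (ell p u1 u2) 0.
  by rewrite ell00// /bil normr0 !mul0r !mulr0 !addr0.
have [/(ell_eq0 q1)[-> ->]|lv] := eqVneq (ell q v1 v2) 0.
  by rewrite ell00// /bil normr0 !mulr0 !addr0.
have [w wI [a a0 [-> -> ->]]] := ell_segment_decomp p1 lu.
have [k kI [d d0 [-> -> ->]]] := ell_segment_decomp q1 lv.
have := smax (w, k).
rewrite inE/= !in_itv/= => /(_ (conj wI kI)).
rewrite -ME {1}/f/= ler_pdivrMr; last first.
  exact: mulr_gt0 (ell_segment_gt0 w p1) (ell_segment_gt0 k q1).
move=> h.
have := ler_wpM2l (ltW (mulr_gt0 a0 d0)) h.
move: M (ell p w (1 - w)) (ell q k (1 - k)) {N0 K0 smax ME h} => M N K h.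
rewrite [leRHS](_ : _ = a * d * (M * (N * K))); last by ring.
by apply: le_trans h; rewrite le_eqVlt /b /bil; apply/orP; left; apply/eqP; ring.
Qed.

End BilinearMaximum.

(** * Near-constant contractive forms are not extreme *)

Section NearConstantForms.
Context {R : realType}.
Implicit Types (p q e : R) (t : 'M[R]_2).

Definition contractive_form p q t := forall u1 u2 v1 v2,
  bil (t 0 0) (t 0 1) (t 1 0) (t 1 1) u1 u2 v1 v2 <= ell p u1 u2 * ell q v1 v2.

Definition det2 t : R := t 0 0 * t 1 1 - t 0 1 * t 1 0.

(** A condition invariant under positive scaling that contains the positive constant matrices when
    [e > 0]. The ratio 2 keeps maximum points away from the axes; the determinant measures the
    distance to rank one. *)
Definition near_constant e t :=
  [/\ forall i j, 0 < t i j, forall i j k l, t i j <= 2 * t k l &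
      `|det2 t| < e * t 0 0 ^+ 2].

Definition mx22 (a b c d : R) : 'M[R]_2 :=
  \matrix_(i, j) (if i == 0 then if j == 0 then a else b
                  else if j == 0 then c else d).

Lemma mx22E a b c d : (mx22 a b c d 0 0 = a) * (mx22 a b c d 0 1 = b) *
  (mx22 a b c d 1 0 = c) * (mx22 a b c d 1 1 = d).
Proof. by rewrite !mxE. Qed.

Lemma ord2P (i : 'I_2) : i = 0 \/ i = 1.
Proof. by case: i => -[|[|//]] ?; [left|right]; exact: val_inj. Qed.

Lemma mx22_ext t1 t2 : t1 0 0 = t2 0 0 -> t1 0 1 = t2 0 1 ->
  t1 1 0 = t2 1 0 -> t1 1 1 = t2 1 1 -> t1 = t2.
Proof.
by move=> *; apply/matrixP => i j; case: (ord2P i) => ->; case: (ord2P j) => ->.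
Qed.

(** Raising the comparison to the power [p/(p-1)] bounds [x1 ^ p] by a multiple of [x2 ^ p], and the
    two sum to 1. *)
Lemma balanced_unit p x1 x2 : 1 < p -> 0 < x1 -> 0 < x2 ->
  x1 `^ p + x2 `^ p = 1 -> x1 `^ (p - 1) <= 2 * x2 `^ (p - 1) ->
  (1 + 2 `^ (p / (p - 1)))^-1 <= x2 `^ p.
Proof.
move=> p1 x10 x20 x12 h; have p10 : p - 1 != 0 by lra.
have r0 : 0 <= p / (p - 1) by rewrite divr_ge0//; lra.
have E x : (x `^ (p - 1)) `^ (p / (p - 1)) = x `^ p.
  by rewrite -powRrM mulrC divfK.
have : x1 `^ p <= 2 `^ (p / (p - 1)) * x2 `^ p.
  rewrite -(E x1) -(E x2) -powRM ?powR_ge0//.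
  by apply: ge0_ler_powR => //; rewrite nnegrE ?mulr_ge0 ?powR_ge0.
have K0 : 0 < 1 + 2 `^ (p / (p - 1)) by rewrite ltr_wpDr ?powR_ge0.
move=> h2; rewrite -[leLHS]div1r ler_pdivrMr//.
move: x12 h2; move: (2 `^ _) (x1 `^ p) (x2 `^ p) => K a b; lra.
Qed.

(* [(x, A^perp)] is the basis dual to [(A, x^perp)], so [T] is diagonal in
   these bases, with diagonal entries [M] and [rho]. *)
Lemma stationary_form_decomp (t11 t12 t21 t22 A1 A2 B1 B2 x1 x2 y1 y2 M : R) :
  t11 * y1 + t12 * y2 = M * A1 -> t21 * y1 + t22 * y2 = M * A2 ->
  t11 * x1 + t21 * x2 = M * B1 -> t12 * x1 + t22 * x2 = M * B2 ->
  A1 * x1 + A2 * x2 = 1 -> B1 * y1 + B2 * y2 = 1 ->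
  exists rho, [/\ t11 = M * (A1 * B1) + rho * (x2 * y2),
    t12 = M * (A1 * B2) - rho * (x2 * y1),
    t21 = M * (A2 * B1) - rho * (x1 * y2) &
    t22 = M * (A2 * B2) + rho * (x1 * y1)].
Proof.
move=> E1 E2 F1 F2 G H.
pose T := bil t11 t12 t21 t22.
have Txy : T x1 x2 y1 y2 = M.
  rewrite -[RHS]mulr1 -G.
  rewrite (_ : T _ _ _ _ = (t11 * y1 + t12 * y2) * x1 + (t21 * y1 + t22 * y2) * x2).
    by rewrite E1 E2; ring.
  by rewrite /T /bil; ring.
have TxB : T x1 x2 B2 (- B1) = 0.
  rewrite (_ : T _ _ _ _ = (t11 * x1 + t21 * x2) * B2 - (t12 * x1 + t22 * x2) * B1).
    by rewrite F1 F2; ring.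
  by rewrite /T /bil; ring.
have TAy : T A2 (- A1) y1 y2 = 0.
  rewrite (_ : T _ _ _ _ = (t11 * y1 + t12 * y2) * A2 - (t21 * y1 + t22 * y2) * A1).
    by rewrite E1 E2; ring.
  by rewrite /T /bil; ring.
exists (T A2 (- A1) B2 (- B1)); set rho := T _ _ _ _.
have expand (a a' b b' : R) :
    T (a * x1 + a' * A2) (a * x2 - a' * A1) (b * y1 + b' * B2) (b * y2 - b' * B1) =
    M * (a * b) + rho * (a' * b').
  transitivity (a * b * T x1 x2 y1 y2 + a * b' * T x1 x2 B2 (- B1) +
    a' * b * T A2 (- A1) y1 y2 + a' * b' * rho).
    by rewrite /rho /T /bil; ring.
  by rewrite Txy TxB TAy; ring.
(* With [A^perp = (A2, -A1)], the unit vectors are [A1 x + x2 A^perp] and [A2 x - x1 A^perp];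
   likewise for [y] and [B]. *)
have e1 : A1 * x1 + x2 * A2 = 1 by rewrite -G; ring.
have e2 : A1 * x2 - x2 * A1 = 0 by ring.
have e3 : A2 * x1 + (- x1) * A2 = 0 by ring.
have e4 : A2 * x2 - (- x1) * A1 = 1 by rewrite -G; ring.
have f1 : B1 * y1 + y2 * B2 = 1 by rewrite -H; ring.
have f2 : B1 * y2 - y2 * B1 = 0 by ring.
have f3 : B2 * y1 + (- y1) * B2 = 0 by ring.
have f4 : B2 * y2 - (- y1) * B1 = 1 by rewrite -H; ring.
have T11 : T 1 0 1 0 = t11 by rewrite /T /bil; ring.
have T12 : T 1 0 0 1 = t12 by rewrite /T /bil; ring.
have T21 : T 0 1 1 0 = t21 by rewrite /T /bil; ring.
have T22 : T 0 1 0 1 = t22 by rewrite /T /bil; ring.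
split.
- by rewrite -T11 -expand e1 e2 f1 f2.
- have := expand A1 x2 B2 (- y1); rewrite e1 e2 f3 f4 T12 => ->; ring.
- have := expand A2 (- x1) B1 y2; rewrite e3 e4 f1 f2 T21 => ->; ring.
- have := expand A2 (- x1) B2 (- y1); rewrite e3 e4 f3 f4 T22 => ->; ring.
Qed.

(** The matrix of [M (j x (x) j y + l x^perp (x) y^perp)], where [x^perp = (x2, -x1)]. *)
Definition perturbed p q (M l x1 x2 y1 y2 : R) : 'M[R]_2 := mx22
  (M * (x1 `^ (p - 1) * y1 `^ (q - 1)) + M * l * (x2 * y2))
  (M * (x1 `^ (p - 1) * y2 `^ (q - 1)) - M * l * (x2 * y1))
  (M * (x2 `^ (p - 1) * y1 `^ (q - 1)) - M * l * (x1 * y2))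
  (M * (x2 `^ (p - 1) * y2 `^ (q - 1)) + M * l * (x1 * y1)).

Lemma bil_perturbed p q M l x1 x2 y1 y2 u1 u2 v1 v2 :
  let t := perturbed p q M l x1 x2 y1 y2 in
  bil (t 0 0) (t 0 1) (t 1 0) (t 1 1) u1 u2 v1 v2 = M *
  ((x1 `^ (p - 1) * u1 + x2 `^ (p - 1) * u2) *
  (y1 `^ (q - 1) * v1 + y2 `^ (q - 1) * v2) +
  l * ((x2 * u1 - x1 * u2) * (y2 * v1 - y1 * v2))).
Proof. by rewrite /bil /perturbed !mx22E; ring. Qed.

Lemma powR_unit p x1 x2 : 1 < p -> 0 < x1 -> 0 < x2 -> x1 `^ p + x2 `^ p = 1 ->
  x1 `^ (p - 1) * x1 + x2 `^ (p - 1) * x2 = 1.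
Proof.
move=> p1 x10 x20; rewrite -[x1 `^ p]mulr_powRB1 -?[x2 `^ p]mulr_powRB1
  ?(ltW x10) ?(ltW x20)//; lra.
Qed.

(** The form is diagonal, with entries [M] and [M l], between the matrices with rows [j x, x^perp]
    and [j y, y^perp], each of determinant -1. *)
Lemma det2_perturbed p q M l x1 x2 y1 y2 :
  x1 `^ (p - 1) * x1 + x2 `^ (p - 1) * x2 = 1 ->
  y1 `^ (q - 1) * y1 + y2 `^ (q - 1) * y2 = 1 ->
  det2 (perturbed p q M l x1 x2 y1 y2) = M ^+ 2 * l.
Proof.
move=> ex ey; rewrite /det2 /perturbed !mx22E.
transitivity (M ^+ 2 * l * (x1 `^ (p - 1) * x1 + x2 `^ (p - 1) * x2) *
  (y1 `^ (q - 1) * y1 + y2 `^ (q - 1) * y2)); first by ring.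
by rewrite ex ey !mulr1.
Qed.

Lemma pos_form_gt0 r (z1 z2 a b : R) : 1 < r -> 0 <= z1 -> 0 <= z2 ->
  z1 `^ r + z2 `^ r = 1 -> 0 < a -> 0 < b -> 0 < a * z1 + b * z2.
Proof.
move=> r1 z10 z20 z12 a0 b0.
have h1 := mulr_ge0 (ltW a0) z10; have h2 := mulr_ge0 (ltW b0) z20.
have r0 : r != 0 by lra.
rewrite lt0r addr_ge0// andbT; apply: contra_eqN z12.
rewrite paddr_eq0// !mulf_eq0 (gt_eqF a0) (gt_eqF b0)/= => /andP[/eqP -> /eqP ->].
by rewrite powR0// addr0 eq_sym oner_eq0.
Qed.

Lemma form_ratio (M a b c d z1 z2 w1 w2 : R) : 0 < M ->
  a <= 2 * c -> b <= 2 * d ->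
  0 <= z1 -> 0 <= z2 -> a * z1 + b * z2 = M * w1 -> c * z1 + d * z2 = M * w2 ->
  w1 <= 2 * w2.
Proof.
move=> M0 ac bd z10 z20 h1 h2; rewrite -(ler_pM2l M0) mulrCA -h1 -h2.
have := ler_wpM2r z10 ac; have := ler_wpM2r z20 bd; lra.
Qed.

Lemma no_near_constant_extreme p q : 1 < p -> 1 < q ->
  exists2 e, 0 < e & forall t, contractive_form p q t -> near_constant e t ->
  exists (s : R) t1 t2, [/\ 0 <= s <= 1, contractive_form p q t1,
    contractive_form p q t2 &
    t = s *: t1 + (1 - s) *: t2] /\ ~ near_constant e t1 /\ ~ near_constant e t2.
Proof.
move=> p1 q1.
(* The bound of [balanced_unit] for both exponents; it depends on [p] and [q] only, hence so does
   [e]. *)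
pose m := Num.min (1 + 2 `^ (p / (p - 1)))^-1 (1 + 2 `^ (q / (q - 1)))^-1.
have m0 : 0 < m.
  by rewrite lt_min !invr_gt0 !ltr_wpDr ?powR_ge0.
have [e e0 He] := @rank_one_plus_contraction R p q m p1 q1 m0.
exists e => // t ct [t0 tr tdet].
have [x1 [x2 [y1 [y2 [[x10 x20 x12] [[y10 y20 y12] tM]]]]]] :=
  bil_max p1 q1 (ltW (t0 0 0)) (ltW (t0 0 1)) (ltW (t0 1 0)) (ltW (t0 1 1)).
set M := bil _ _ _ _ x1 x2 y1 y2 in tM.
have lx := ell_unit x10 x20 x12; have ly := ell_unit y10 y20 y12.
have M1 : M <= 1 by have := ct x1 x2 y1 y2; rewrite lx ly mulr1.
have [x1p x2p E1 E2] : [/\ 0 < x1, 0 < x2,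
    t 0 0 * y1 + t 0 1 * y2 = M * x1 `^ (p - 1) &
    t 1 0 * y1 + t 1 1 * y2 = M * x2 `^ (p - 1)].
  apply: (norming_gradient p1 _ _ x10 x20 x12).
  - exact: pos_form_gt0 q1 y10 y20 y12 (t0 0 0) (t0 0 1).
  - exact: pos_form_gt0 q1 y10 y20 y12 (t0 1 0) (t0 1 1).
  - by rewrite /M /bil; ring.
  - move=> u1 u2; have := tM u1 u2 y1 y2; rewrite ly mulr1.
    by apply: le_trans; rewrite le_eqVlt /bil; apply/orP; left; apply/eqP; ring.
have [y1p y2p F1 F2] : [/\ 0 < y1, 0 < y2,
    t 0 0 * x1 + t 1 0 * x2 = M * y1 `^ (q - 1) &
    t 0 1 * x1 + t 1 1 * x2 = M * y2 `^ (q - 1)].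
  apply: (norming_gradient q1 _ _ y10 y20 y12).
  - exact: pos_form_gt0 p1 x10 x20 x12 (t0 0 0) (t0 1 0).
  - exact: pos_form_gt0 p1 x10 x20 x12 (t0 0 1) (t0 1 1).
  - by rewrite /M /bil; ring.
  - move=> u1 u2; have := tM x1 x2 u1 u2; rewrite lx mul1r.
    by apply: le_trans; rewrite le_eqVlt /bil; apply/orP; left; apply/eqP; ring.
have M0 : 0 < M.
  have := pos_form_gt0 q1 y10 y20 y12 (t0 0 0) (t0 0 1).
  by rewrite E1 pmulr_lgt0// powR_gt0.
have mx1 : m <= x1 `^ p.
  rewrite ge_min; apply/orP; left; apply: (balanced_unit p1 x2p x1p).
    by rewrite addrC.
  exact: form_ratio M0 (tr 1 0 0 0) (tr 1 1 0 1) y10 y20 E2 E1.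
have mx2 : m <= x2 `^ p.
  rewrite ge_min; apply/orP; left; apply: (balanced_unit p1 x1p x2p x12).
  exact: form_ratio M0 (tr 0 0 1 0) (tr 0 1 1 1) y10 y20 E1 E2.
have my1 : m <= y1 `^ q.
  rewrite ge_min; apply/orP; right; apply: (balanced_unit q1 y2p y1p).
    by rewrite addrC.
  exact: form_ratio M0 (tr 0 1 0 0) (tr 1 1 1 0) x10 x20 F2 F1.
have my2 : m <= y2 `^ q.
  rewrite ge_min; apply/orP; right; apply: (balanced_unit q1 y1p y2p y12).
  exact: form_ratio M0 (tr 0 0 0 1) (tr 1 0 1 1) x10 x20 F1 F2.
have {}He := He _ _ _ _ x1p x2p y1p y2p x12 y12 mx1 mx2 my1 my2.
have Gx := powR_unit p1 x1p x2p x12; have Gy := powR_unit q1 y1p y2p y12.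
have [rho [t11 t12 t21 t22]] := stationary_form_decomp E1 E2 F1 F2 Gx Gy.
pose T l := perturbed p q M l x1 x2 y1 y2.
have tE : t = T (rho / M).
  have rE : M * (rho / M) = rho by rewrite mulrC divfK// gt_eqF.
  by apply: mx22_ext; rewrite /T /perturbed mx22E rE.
have cT l : `|l| <= e -> contractive_form p q (T l).
  move=> le u1 u2 v1 v2; rewrite /T bil_perturbed.
  apply: le_trans (ler_wpM2l (ltW M0) (He l u1 u2 v1 v2 le)) _.
  exact: ler_piMl (mulr_ge0 (ell_ge0 _ _ _) (ell_ge0 _ _ _)) M1.
have ell10 r : 1 < r -> ell r 1 0 = 1.
  move=> r1; have r0 : r != 0 by move: r1; clear; lra.
    by rewrite (ell_unit ler01 (lexx 0))// powR1 powR0// addr0.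
(* The determinant has absolute value [e M^2], while testing on first basis vectors shows that the
   corner entry is at most [M]. *)
have far l : `|l| = e -> ~ near_constant e (T l).
  move=> le [T0 _]; rewrite /T det2_perturbed// normrM le ger0_norm ?sqr_ge0//.
  have T00 : T l 0 0 <= M.
    have := He l 1 0 1 0; rewrite le lexx !ell10// [1 * 1]mulr1 => /(_ isT).
    have := bil_perturbed p q M l x1 x2 y1 y2 1 0 1 0; rewrite -/(T l).
    move=> hb h; have := ler_wpM2l (ltW M0) h; rewrite [M * 1]mulr1 -hb /bil.
    by rewrite !mulr0 mul0r !mulr0 !mulr1 !addr0.
  rewrite mulrC ltr_pM2l// ltNge; apply/negP; rewrite negbK.
  by rewrite ler_sqr ?nnegrE ?(ltW M0) ?(ltW (T0 0 0)).
have t00 : t 0 0 <= M.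
  have := tM 1 0 1 0; rewrite !ell10// !mulr1; apply: le_trans.
  by rewrite le_eqVlt /bil; apply/orP; left; apply/eqP; ring.
have rhoe : `|rho / M| < e.
  have M20 : 0 < M ^+ 2 by rewrite exprn_gt0.
  rewrite -(ltr_pM2l M20) -[X in X * `|_| < _]ger0_norm ?(ltW M20)//.
  rewrite -normrM -(det2_perturbed M (rho / M) Gx Gy) -/(T _) -tE.
  apply: lt_le_trans tdet _; rewrite mulrC ler_pM2r//.
  by rewrite ler_sqr ?nnegrE ?(ltW M0) ?(ltW (t0 0 0)).
(* The weight solves [s e - (1 - s) e = rho / M], and [T l] is affine in [l]. *)
exists ((e + rho / M) / (2 * e)), (T e), (T (- e)); split; [split|split].
- move: rhoe; rewrite ltr_norml => /andP[h1 h2].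
  have e20 : 0 < 2 * e by rewrite mulr_gt0.
  have n0 : 0 <= e + rho / M by rewrite -lerBlDl sub0r ltW.
  rewrite (divr_ge0 n0 (ltW e20))/=.
  by rewrite ler_pdivrMr// mul1r mulr_natl mulr2n lerD2l ltW.
- by apply: cT; rewrite gtr0_norm.
- by apply: cT; rewrite normrN gtr0_norm.
- rewrite {1}tE; apply: mx22_ext; rewrite /T /perturbed [RHS]mxE
    [X in _ = X + _]mxE [X in _ = _ + X]mxE !mx22E.
  + by field; rewrite !gt_eqF.
  + by field; rewrite !gt_eqF.
  + by field; rewrite !gt_eqF.
  + by field; rewrite !gt_eqF.
- by apply: far; rewrite gtr0_norm.
- by apply: far; rewrite normrN gtr0_norm.
Qed.

End NearConstantForms.

(** * Duality for the projective tensor product *)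

Lemma nonexpansive_continuous (R : realType) (V : normedModType R) (f : V -> R) :
  (forall u v, `|f u - f v| <= `|u - v|) -> continuous f.
Proof.
move=> fL u; apply/cvgrPdist_le => e e0; near=> v.
apply: le_trans (fL _ _) _.
by near: v; exact: cvgr_dist_le.
Unshelve. all: by end_near. Qed.

Section ProjectiveDuality.
Context {R : realType} {p q : R} (hp : 1 < p) (hq : 1 < q).
Local Notation E := (lp2_ptensor hp hq).
Implicit Types (t : 'M[R]_2).

Definition pair_mx t (u : 'M[R]_2) : R := \sum_i \sum_j t i j * u i j.

Lemma pair_mxE t (u : 'M[R]_2) : pair_mx t u =
  t 0 0 * u 0 0 + t 0 1 * u 0 1 + (t 1 0 * u 1 0 + t 1 1 * u 1 1).
Proof.
rewrite /pair_mx !big_ord_recl !big_ord0 !addr0.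
by rewrite (_ : lift ord0 ord0 = 1)//; exact: val_inj.
Qed.

Lemma pair_mxD t (u v : 'M[R]_2) : pair_mx t (u + v) = pair_mx t u + pair_mx t v.
Proof. by rewrite !pair_mxE !mxE; ring. Qed.

Lemma pair_mxN t (u : 'M[R]_2) : pair_mx t (- u) = - pair_mx t u.
Proof. by rewrite !pair_mxE !mxE; ring. Qed.

Lemma pair_mx_convl s t1 t2 (u : 'M[R]_2) :
  pair_mx (s *: t1 + (1 - s) *: t2) u = s * pair_mx t1 u + (1 - s) * pair_mx t2 u.
Proof. by rewrite !pair_mxE !mxE; ring. Qed.

Lemma pair_mx_outer t (x y : 'rV[R]_2) : pair_mx t (outer x y) =
  bil (t 0 0) (t 0 1) (t 1 0) (t 1 1) (x 0 0) (x 0 1) (y 0 0) (y 0 1).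
Proof. by rewrite pair_mxE !outerE /bil; ring. Qed.

(** Each representation of [u] bounds the pairing by its cost. With the converse below, contractive
    forms make up the dual unit ball. *)
Lemma contractive_form_le_norm t (u : E) :
  contractive_form p q t -> pair_mx t u <= `|u|.
Proof.
move=> ct; apply: lb_le_inf; first exact: projective_costs_nonempty.
move=> _ [n [x [y [-> ->]]]].
have -> : pair_mx t (\sum_(i < n) tens (x i) (y i)) =
    \sum_(i < n) pair_mx t (tens (x i) (y i)).
  apply: (big_morph (pair_mx t) (id1 := 0) (op1 := +%R)) => [a b|].
    exact: pair_mxD.
  by rewrite pair_mxE !mxE !mulr0 !addr0.
apply: ler_sum => i _; rewrite pair_mx_outer; apply: le_trans (ct _ _ _ _) _.
by rewrite !lp2_normE.
Qed.

Lemma norm_tens_le (x : lp2 hp) (y : lp2 hq) : `|tens x y| <= `|x| * `|y|.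
Proof.
apply: projective_norm_le; exists 1%N, (fun=> x), (fun=> y).
by rewrite !big_ord1.
Qed.

Lemma le_norm_contractive_form t : (forall u : E, pair_mx t u <= `|u|) ->
  contractive_form p q t.
Proof.
move=> tn u1 u2 v1 v2.
have := tn (tens (row2 u1 u2 : lp2 hp) (row2 v1 v2 : lp2 hq)).
rewrite pair_mx_outer !mxE/= => /le_trans; apply.
by apply: le_trans (norm_tens_le _ _) _; rewrite !norm_row2.
Qed.

(** The norm is first lowered in direction [z], which forces [Q (- z) <= - |z|] for all later
    minorants, and then made odd at the matrix units. *)
Lemma norming_contractive_form (z : E) : exists t, contractive_form p q t /\
  `|z| <= pair_mx t z.
Proof.
have sN : sublinear (fun u : E => `|u|).
  split=> [u v|a u a0]; first exact: ler_normD.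
  by rewrite normrZ ger0_norm.
have [Q0 [sQ0 Q0N Q0z]] := sublinear_minorant z sN.
pose s : seq E := [seq (delta_mx ij.1 ij.2 : 'M[R]_2)
  | ij <- enum {: 'I_2 * 'I_2}].
have [Q [sQ QQ0 Qs]] := sublinear_minorant_seq s sQ0.
have Qd i j : Q (- (delta_mx i j : 'M[R]_2) : E) = - Q (delta_mx i j : 'M[R]_2).
  by apply: Qs; apply/mapP; exists (i, j); rewrite ?mem_enum.
pose t : 'M[R]_2 := \matrix_(i, j) Q (delta_mx i j : 'M[R]_2).
have QZ i j a : Q ((a *: delta_mx i j : 'M[R]_2) : E) = a * t i j.
  rewrite mxE; have [a0|a0] := leP 0 a; first by rewrite -sQ.2.
  have -> : a *: delta_mx i j = - a *: - (delta_mx i j : 'M[R]_2).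
    by rewrite scaleNr scalerN opprK.
  rewrite (sQ.2 (- a) (- (delta_mx i j : 'M[R]_2) : E)) ?oppr_ge0 ?ltW//.
  by rewrite Qd mulrNN.
have Qsum (I : Type) (r : seq I) (F : I -> E) :
    Q (\sum_(i <- r) F i) <= \sum_(i <- r) Q (F i).
  elim: r => [|i r IH]; first by rewrite !big_nil (sublinear0 sQ).
  by rewrite !big_cons; apply: le_trans (sQ.1 _ _) _; rewrite lerD2l.
(* Subadditivity over the expansion in matrix units; the same bound at [- u] turns it into an
   equality. *)
have Qle (u : E) : Q u <= pair_mx t u.
  rewrite {1}[u]matrix_sum_delta; apply: le_trans (Qsum _ _ _) _.
  apply: ler_sum => i _; apply: le_trans (Qsum _ _ _) _.
  by apply: ler_sum => j _; rewrite QZ mulrC.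
have QE (u : E) : Q u = pair_mx t u.
  apply/eqP; rewrite eq_le Qle/=.
  have := Qle (- u); rewrite pair_mxN.
  have := sQ.1 u (- u); rewrite subrr (sublinear0 sQ); lra.
exists t; split.
  apply: le_norm_contractive_form => u; rewrite -QE.
  exact: le_trans (QQ0 _) (Q0N _).
rewrite -QE; have := le_trans (QQ0 _) Q0z.
have := sQ.1 z (- z); rewrite subrr (sublinear0 sQ); lra.
Qed.

(** * The test set, its separating forms and the conclusion *)

Definition test_set (K : R) : set E :=
  [set c | pair_mx (const_mx 1) c = -1 /\ forall i j, `|(c : 'M[R]_2) i j| <= K].

Lemma coord_nonexpansive i j (u v : E) :
  `|(u : 'M[R]_2) i j - (v : 'M[R]_2) i j| <= `|u - v|.
Proof.
have -> : (u : 'M[R]_2) i j - (v : 'M[R]_2) i j = (u - v : 'M[R]_2) i j.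
  by rewrite !mxE.
exact: entry_le_projective_norm.
Qed.

Lemma coord_continuous i j : continuous (fun u : E => (u : 'M[R]_2) i j).
Proof. exact: nonexpansive_continuous (coord_nonexpansive i j). Qed.

Lemma test_set_closed K : closed (test_set K).
Proof.
have -> : test_set K = [set c : E | pair_mx (const_mx 1) c = -1] `&`
    \bigcap_(ij in [set: 'I_2 * 'I_2])
      [set c : E | `|(c : 'M[R]_2) ij.1 ij.2| <= K].
  apply/seteqP; split=> c /= [c1 cK]; split=> //.
    by move=> ij _; exact: cK.
  by move=> i j; exact: (cK (i, j)).
apply: closedI.
  apply: (@preimage_closed _ _ (fun c : E => pair_mx (const_mx 1) c) [set -1]).
    move=> c _.
    have -> : (fun c : E => pair_mx (const_mx 1) c) = (fun c : E =>
        (c : 'M[R]_2) 0 0 + (c : 'M[R]_2) 0 1 +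
        ((c : 'M[R]_2) 1 0 + (c : 'M[R]_2) 1 1)).
      by apply/funext => u; rewrite pair_mxE !mxE !mul1r.
    exact: cvgD (cvgD (@coord_continuous 0 0 c) (@coord_continuous 0 1 c))
                (cvgD (@coord_continuous 1 0 c) (@coord_continuous 1 1 c)).
  exact: closed_eq.
apply: closed_bigI => -[i j] _.
apply: (@preimage_closed _ _ (fun c : E => `|(c : 'M[R]_2) i j|)
  [set x | x <= K]).
  move=> c _; apply: nonexpansive_continuous => u v.
  exact: le_trans (ler_dist_dist _ _) (coord_nonexpansive i j u v).
exact: closed_le.
Qed.

Lemma test_set_bounded K : bounded_set (test_set K).
Proof.
exists (\sum_i \sum_j K * `|(delta_mx i j : 'M[R]_2) : E|); split.
  exact: num_real.
move=> r Kr c [_ cK]; apply: le_trans (ltW Kr).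
rewrite [c]matrix_sum_delta; apply: le_trans (ler_norm_sum _ _ _) _.
apply: ler_sum => i _; apply: le_trans (ler_norm_sum _ _ _) _.
apply: ler_sum => j _.
have -> : `|(c i j *: delta_mx i j : 'M[R]_2) : E| =
    `|c i j| * `|(delta_mx i j : 'M[R]_2) : E|.
  exact: (normrZ (c i j) ((delta_mx i j : 'M[R]_2) : E)).
by rewrite ler_wpM2r.
Qed.

Lemma test_set_convex K : @convex_set R E (test_set K).
Proof.
move=> x y l; rewrite !inE => -[x1 xK] [y1 yK].
have l0 : 0 <= l%:num by [].
have l1 : l%:num <= 1 by [].
have -> : (conv l x y : E) = l%:num *: (x : E) + (1 - l%:num) *: (y : E) by [].
split.
  move: x1 y1; rewrite !pair_mxE !mxE; nra.
move=> i j; rewrite !mxE.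
apply: le_trans (ler_normD _ _) _; rewrite !normrM.
rewrite (ger0_norm l0) (@ger0_norm _ (1 - l%:num)) ?subr_ge0//.
have := ler_wpM2l l0 (xK i j).
have := @ler_wpM2l _ (1 - l%:num) ltac:(by rewrite subr_ge0) _ _ (yK i j).
lra.
Qed.

(* Moving mass [N] between two coordinates inside the test set compares the
   corresponding entries of [t]. *)
Lemma separating_near_constant e N t : 0 < e -> 4 + 9 / e <= N ->
  (forall c, test_set (N + 1) c -> pair_mx t c < 0) -> near_constant e t.
Proof.
move=> e0 eN ht; have N4 : 4 < N by apply: lt_le_trans eN; rewrite ltrDl divr_gt0.
have N0 : 0 < N by lra.
pose m := pair_mx t (const_mx 4^-1).
have cmp i j k l : N * (t k l - t i j) < m.
  (* The entries of [c] sum to -1 and are at most [N + 1] in absolute value; [m] is the mean of the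
     entries of [t]. *)
  pose c : 'M[R]_2 := N *: (delta_mx k l - delta_mx i j) - const_mx 4^-1.
  have pd i' j' s : pair_mx s (delta_mx i' j') = s i' j'.
    rewrite /pair_mx (bigD1 i')//= (bigD1 j')//= !mxE !eqxx mulr1.
    rewrite !big1 ?addr0// => [i1|j1] ne; last first.
      by rewrite mxE (negPf ne) andbF mulr0.
    by rewrite big1// => j1 _; rewrite mxE (negPf ne) mulr0.
  have pc s : pair_mx s c = N * (s k l - s i j) - pair_mx s (const_mx 4^-1).
    by rewrite -!pd !pair_mxE !mxE; ring.
  have := ht c; rewrite pc subr_lt0; apply; split.
    by rewrite pc !mxE subrr mulr0 sub0r pair_mxE !mxE; congr (- _); field.
  move=> i' j'; rewrite !mxE.
  apply: le_trans (ler_normB _ _) _; apply: lerD; last first.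
    by rewrite ger0_norm ?invr_ge0 ?invf_le1 ?ler1n ?ler0n ?ltr0n.
  rewrite normrM (gtr0_norm N0) -[leRHS]mulr1 ler_pM2l//.
  by case: (_ && _); case: (_ && _);
    rewrite ?subrr ?subr0 ?sub0r ?normr0 ?normrN ?normr1.
have mE : m = (t 0 0 + t 0 1 + t 1 0 + t 1 1) / 4.
  by rewrite /m pair_mxE !mxE; field.
have m0 : 0 < m by have := cmp 0 0 0 0; rewrite subrr mulr0.
pose d := m / N.
have d0 : 0 < d by rewrite divr_gt0.
(* Every entry lies within [d] of [m], so [4 d < m] bounds the ratios by 5/3. *)
have dm : 4 * d < m by rewrite /d mulrA ltr_pdivrMr// mulrC ltr_pM2l.
have cmpd i j k l : t k l - t i j < d by rewrite ltr_pdivlMr// mulrC.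
have lo i j : m - d < t i j.
  have := cmpd i j 0 0; have := cmpd i j 0 1.
  have := cmpd i j 1 0; have := cmpd i j 1 1; lra.
have hi i j : t i j < m + d.
  have := cmpd 0 0 i j; have := cmpd 0 1 i j.
  have := cmpd 1 0 i j; have := cmpd 1 1 i j; lra.
split.
- by move=> i j; apply: lt_trans (lo i j); lra.
- by move=> i j k l; have := hi i j; have := lo k l; lra.
have prod_lo i j k l : (m - d) ^+ 2 < t i j * t k l.
  by rewrite expr2; apply: ltr_pM => //; lra.
have prod_hi i j k l : t i j * t k l < (m + d) ^+ 2.
  by rewrite expr2; apply: ltr_pM => //; apply: ltW;
    apply: lt_trans (lo _ _); lra.
have det_le : `|det2 t| <= 4 * (m * d).
  rewrite ler_norml /det2.
  have := prod_lo 0 0 1 1; have := prod_hi 0 0 1 1.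
  have := prod_lo 0 1 1 0; have := prod_hi 0 1 1 0.
  by move=> *; apply/andP; split; lra.
apply: le_lt_trans det_le _.
(* This uses [N > 9/e]. As [t 0 0 >= 3m/4], the target [e (t 0 0)^2] exceeds [81/16 m d], hence
   [4 m d]. *)
have ed : 9 * d < e * m.
  rewrite /d mulrA ltr_pdivrMr// -mulrA mulrCA [9 * m]mulrC ltr_pM2l//.
  rewrite mulrC -ltr_pdivrMr//; lra.
have t2 : (3 / 4 * m) ^+ 2 <= t 0 0 ^+ 2.
  have h : 3 / 4 * m <= t 0 0 by have := lo 0 0; lra.
  by rewrite ler_sqr// nnegrE; lra.
have h1 := ler_wpM2l (ltW e0) t2.
have h2 : m * (9 * d) < m * (e * m) by rewrite ltr_pM2l.
have h3 := mulr_gt0 m0 d0.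
lra.
Qed.

Lemma lp2_ptensor_not_mip : ~ mazur_intersection_property E.
Proof.
move=> mip; have [e e0 He] := no_near_constant_extreme hp hq.
pose N := 4 + 9 / e.
have [F [Fpos FE]] := mip _ (@test_set_closed (N + 1)) (@test_set_bounded (N + 1))
  (@test_set_convex (N + 1)).
have : ~ test_set (N + 1) 0.
  by case; rewrite pair_mxE !mxE !mulr0 !addr0 => h; lra.
rewrite {1}FE; apply => -[y r] Fyr /=.
have r0 : 0 < r := Fpos _ Fyr.
rewrite closed_ballE// /closed_ball_ /= subr0 leNgt; apply/negP => ry.
(* For [c] in the ball, [t (c - y) <= r < t (- y)], so [t c < 0] on the whole test set. *)
have sep t : contractive_form p q t -> r < pair_mx t (- y) -> near_constant e t.
  move=> ct rt; apply: (@separating_near_constant e N) => // c.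
  rewrite {1}FE => /(_ _ Fyr);
  rewrite /= closed_ballE// /closed_ball_ /= distrC => cr.
  have := le_trans (contractive_form_le_norm (c - y) ct) cr.
  by move: rt; rewrite pair_mxD; lra.
have [t [ct ht]] := norming_contractive_form (- y).
have rt : r < pair_mx t (- y) by apply: lt_le_trans ht; rewrite normrN.
have [s [t1 [t2 [[/andP[s0 s1] ct1 ct2 tE] [n1 n2]]]]] := He t ct (sep t ct rt).
have le1 : pair_mx t1 (- y) <= r by rewrite leNgt; apply/negP => /(sep _ ct1).
have le2 : pair_mx t2 (- y) <= r by rewrite leNgt; apply/negP => /(sep _ ct2).
have := ler_wpM2l s0 le1.
have := @ler_wpM2l _ (1 - s) ltac:(by rewrite subr_ge0) _ _ le2.
by move: rt; rewrite tE pair_mx_convl; lra.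
Qed.

End ProjectiveDuality.

Theorem theorem4p2 (R : realType) (p q : R) (hp : 1 < p) (hq : 1 < q) :
  (p^-1 + q^-1 = 1 -> ~ mazur_intersection_property (lp2_ptensor hp hq)) /\
  (p = 2 \/ q = 2 -> ~ mazur_intersection_property (lp2_ptensor hp hq)) /\
  (2 < p -> 2 < q -> ~ mazur_intersection_property (lp2_ptensor hp hq)).
Proof.
by split; [|split] => *; exact: lp2_ptensor_not_mip.
Qed.
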